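(* Let $\mathsf{L}$ and $\mathsf{K}$ be simplicial complexes. (1) The inequality $$\chi(\mathsf{L})\leq\chi(\mathsf{K})^{\mathrm{C}(\mathsf{L};\mathsf{K})}$$ holds. Equivalently, $\log_{\chi(\mathsf{K})}\chi(\mathsf{L})\leq \mathrm{C}(\mathsf{L};\mathsf{K})$. (2) Suppose that $\mathsf{K}$ has no isolated vertices. Then $$\mathrm{C}(G_{\mathsf{L}};G_{\mathsf{K}})\leq \mathrm{C}(\mathsf{L};\mathsf{K}).$$
   Context: A simplicial complex is an abstract simplicial complex: a set $\mathsf{K}$ of subsets (simplices) of a vertex set $V(\mathsf{K})=\bigcup\mathsf{K}$ such that $F\in\mathsf{K}$ and $G\subseteq F$ imply $G\in\mathsf{K}$. The dimension of a simplex $F$ is $|F|-1$. A facet is a simplex that is maximal with respect to inclusion; a facet is non-unitary if it has at least two vertices. A vertex is isolated if it lies in no simplex containing another vertex. A subcomplex of $\mathsf{K}$ is a simplicial complex contained in $\mathsf{K}$. The union of simplicial complexes is the union of their vertex sets and of their sets of simplices. A simplicial map $f:\mathsf{L}\to\mathsf{K}$ is a map $f:V(\mathsf{L})\to V(\mathsf{K})$ such that $f(F)\in\mathsf{K}$ whenever $F\in\mathsf{L}$. A facet simplicial map is a simplicial map $f:\mathsf{L}\to\mathsf{K}$ such that $f(F)$ is a non-unitary facet of $\mathsf{K}$ whenever $F$ is a non-unitary facet of $\mathsf{L}$. The facet-complexity $\mathrm{C}(\mathsf{L};\mathsf{K})$ is the least positive integer $k$ such that there exist subcomplexes $\mathsf{L}_1,\ldots,\mathsf{L}_k$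 of $\mathsf{L}$ with $\mathsf{L}=\mathsf{L}_1\cup\cdots\cup\mathsf{L}_k$ and, for each $i$, a facet simplicial map $f_i:\mathsf{L}_i\to\mathsf{K}$; it is $\infty$ if no such $k$ exists. In (1), the right-hand side is read as $\infty$ (so the inequality is trivially true) when $\mathrm{C}(\mathsf{L};\mathsf{K})=\infty$, and the logarithmic form is meant when $\chi(\mathsf{K})\geq 2$. The chromatic number $\chi(\mathsf{L})$ of a simplicial complex is the least $k$ such that the vertices of $\mathsf{L}$ can be colored with $k$ colors so that no non-unitary facet of $\mathsf{L}$ has all its vertices of the same color. For a simplicial complex $\mathsf{L}$, $G_{\mathsf{L}}$ denotes the graph whose edges are the facets of $\mathsf{L}$ of dimension $1$ and whose vertex set is the union of these edges. For graphs $G,H$, the hom-complexity $\mathrm{C}(G;H)$ is the least positive integer $k$ such that there exist subgraphs $G_1,\ldots,G_k$ of $G$ with $G=G_1\cup\cdots\cup G_k$ and, for each $i$, a graph homomorphism $G_i\to H$ (and $\infty$ if no such $k$ exists). *)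

(* Defs.v *)
From HB Require Import structures.
From mathcomp Require Import all_boot all_order all_algebra.
From mathcomp Require Import boolp classical_sets functions cardinality.
From mathcomp Require Import reals constructive_ereal ereal exp.
Set Implicit Arguments.
Unset Strict Implicit.
Unset Printing Implicit Defensive.
Import Order.TTheory GRing.Theory Num.Theory.
Local Open Scope classical_set_scope.
Local Open Scope card_scope.

Definition least (R : realType) (P : nat -> Prop) : \bar R :=
  if pselect (exists k, `[< P k >]) is left exP
  then ((ex_minn exP)%:R%R)%:E else +oo%E.

(* Maps between vertex sets are functions between the subtypes [set_type A],
   so that an empty vertex set always has a (unique) map to any other one. *)
Definition sub_image (T U : Type) (A : set T) (B : set U) (f : A -> B)
  (F : set T) : set U := [set \val (f x) | x in [set x : A | F (\val x)]].

(* Neither the complex nor its simplices are assumed finite, and the void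
   complex (without even the empty simplex) is allowed. *)
Record simplicial_complex (T : Type) := SimplicialComplex {
  simplices :> set (set T);
  simplices_down : forall F G, simplices F -> G `<=` F -> simplices G
}.

Definition vertices (T : Type) (K : simplicial_complex T) : set T :=
  \bigcup_(F in simplices K) F.

Definition facet (T : Type) (K : simplicial_complex T) (F : set T) : Prop :=
  simplices K F /\ forall G, simplices K G -> F `<=` G -> G = F.

Definition nonunitary_facet (T : Type) (K : simplicial_complex T)
  (F : set T) : Prop := facet K F /\ `I_2 #<= F.

Definition isolated_vertex (T : Type) (K : simplicial_complex T) (v : T) : Prop :=
  vertices K v /\
  ~ exists F w, [/\ simplices K F, F v, F w & w <> v].

Definition subcomplex (T : Type) (L' L : simplicial_complex T) : Prop :=
  simplices L' `<=` simplices L.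

Definition simplicial_map (T U : Type) (L : simplicial_complex T)
  (K : simplicial_complex U) (f : vertices L -> vertices K) : Prop :=
  forall F, simplices L F -> simplices K (sub_image f F).

Definition facet_simplicial_map (T U : Type) (L : simplicial_complex T)
  (K : simplicial_complex U) (f : vertices L -> vertices K) : Prop :=
  simplicial_map f /\
  forall F, nonunitary_facet L F -> nonunitary_facet K (sub_image f F).

Definition facet_complexity (R : realType) (T U : Type)
  (L : simplicial_complex T) (K : simplicial_complex U) : \bar R :=
  least R (fun k => (0 < k)%N /\
    exists Ls : 'I_k -> simplicial_complex T,
      [/\ forall i, subcomplex (Ls i) L,
          simplices L = \bigcup_i simplices (Ls i) &
          forall i, exists f : vertices (Ls i) -> vertices K,
            facet_simplicial_map f]).

Definition proper_coloring (T : Type) (L : simplicial_complex T) (k : nat)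
  (c : vertices L -> 'I_k) : Prop :=
  forall F, nonunitary_facet L F ->
    ~ exists a : 'I_k, forall x : vertices L, F (\val x) -> c x = a.

Definition chromatic_number (R : realType) (T : Type)
  (L : simplicial_complex T) : \bar R :=
  least R (fun k => exists c : vertices L -> 'I_k, proper_coloring c).

(* Simple undirected graphs; edges are two-element sets of vertices. *)
Record sgraph (T : Type) := SGraph {
  gverts : set T;
  gedges : set (set T);
  gedges_card : forall e, gedges e -> e #= `I_2;
  gedges_verts : forall e, gedges e -> e `<=` gverts
}.

Definition subgraph (T : Type) (G' G : sgraph T) : Prop :=
  gverts G' `<=` gverts G /\ gedges G' `<=` gedges G.

Definition graph_hom (T U : Type) (G : sgraph T) (H : sgraph U)
  (f : gverts G -> gverts H) : Prop :=
  forall e, gedges G e -> gedges H (sub_image f e).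

Definition hom_complexity (R : realType) (T U : Type)
  (G : sgraph T) (H : sgraph U) : \bar R :=
  least R (fun k => (0 < k)%N /\
    exists Gs : 'I_k -> sgraph T,
      [/\ forall i, subgraph (Gs i) G,
          gverts G = \bigcup_i gverts (Gs i),
          gedges G = \bigcup_i gedges (Gs i) &
          forall i, exists f : gverts (Gs i) -> gverts H, graph_hom f]).

Definition edge_facets (T : Type) (L : simplicial_complex T) : set (set T) :=
  [set F | facet L F /\ F #= `I_2].

Lemma edge_facets_card (T : Type) (L : simplicial_complex T) (e : set T) :
  edge_facets L e -> e #= `I_2.
Proof. by case. Qed.

Lemma edge_facets_verts (T : Type) (L : simplicial_complex T) (e : set T) :
  edge_facets L e -> e `<=` \bigcup_(F in edge_facets L) F.
Proof. by move=> Ee x ex; exists e. Qed.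

Definition facet_graph (T : Type) (L : simplicial_complex T) : sgraph T :=
  SGraph (@edge_facets_card T L) (@edge_facets_verts T L).

(* [x ^ y], read as [+oo] when [y = +oo] whatever [x] is (even 0 or 1). *)
Definition epow (R : realType) (x y : \bar R) : \bar R :=
  if y is r%:E then poweR x r else +oo%E.

(* Logarithm of [x] in base [b], only meant for finite [b > 1];
   it is [-oo] at [x = 0] and [+oo] at [x = +oo]. *)
Definition elog (R : realType) (b x : \bar R) : \bar R := (lne x / lne b)%E.

(* Main.v *)
Require Import Defs.
From mathcomp Require Import all_boot all_order all_algebra.
From mathcomp Require Import boolp classical_sets functions cardinality.
From mathcomp Require Import reals constructive_ereal ereal exp.
Import Order.TTheory GRing.Theory Num.Theory.
Local Open Scope ereal_scope.

(** A facet of [L] lying in a subcomplex of [L] is a facet of that subcomplex.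
    Hence colorings of [K] pull back along the [f_i], and coloring a vertex
    of [L] by the tuple of its pulled-back colors uses [n ^ k] colors and is
    proper. Likewise an edge facet of [L] lying in [L_i] is sent by [f_i] to a
    facet with at least and at most two vertices, so the [f_i] restrict to
    graph homomorphisms. *)

(** Minimality is deliberately forgotten: a case analysis yields either [+oo] or a mere witness, and
    upper bounds come from [least_le]. *)
Variant least_spec (R : realType) (P : nat -> Prop) : \bar R -> Prop :=
  | LeastInfinite : least_spec R P +oo
  | LeastFinite k of P k : least_spec R P k%:R%:E.

Lemma leastP (R : realType) (P : nat -> Prop) : least_spec R P (least R P).
Proof.
rewrite /least; case: pselect => [exP|_]; last exact: LeastInfinite.
by case: ex_minnP => k /asboolP Pk _; apply: LeastFinite.
Qed.

Lemma least_le {R : realType} {P : nat -> Prop} {k : nat} :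
  P k -> least R P <= k%:R%:E.
Proof.
move=> Pk; rewrite /least; case: pselect => [exP|]; last first.
  by case; exists k; apply/asboolP.
by case: ex_minnP => m _ min_m; rewrite lee_fin ler_nat min_m//; apply/asboolP.
Qed.

Lemma vertices_simplex {T : Type} {L : simplicial_complex T} {F : set T}
    {x : T} : simplices L F -> F x -> vertices L x.
Proof. by move=> LF Fx; exists F. Qed.

Lemma facet_sub {T : Type} {L' L : simplicial_complex T} {F : set T} :
  subcomplex L' L -> simplices L' F -> facet L F -> facet L' F.
Proof. by move=> L'L L'F [_ maxF]; split=> // G /L'L; apply: maxF. Qed.

(** A non-unitary facet that is monochromatic for [c \o f] would have as image a non-unitary facet
    that is monochromatic for [c]. *)
Lemma proper_coloring_comp {T U : Type} {L : simplicial_complex T}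
    {K : simplicial_complex U} {f : vertices L -> vertices K} {n : nat}
    {c : vertices K -> 'I_n} :
  facet_simplicial_map f -> proper_coloring c -> proper_coloring (c \o f).
Proof.
move=> [_ ff] cP F /ff /cP fF [a ca]; apply: fF; exists a => y [x Fx fxy].
by rewrite -(val_inj fxy); apply: ca.
Qed.

Lemma proper_coloring_cover {T : Type} {L : simplicial_complex T} {k n : nat}
    {Ls : 'I_k -> simplicial_complex T} :
  (forall i, subcomplex (Ls i) L) ->
  simplices L = (\bigcup_i simplices (Ls i))%classic ->
  (forall i, exists c : vertices (Ls i) -> 'I_n, proper_coloring c) ->
  exists c : vertices L -> 'I_(n ^ k), proper_coloring c.
Proof.
move=> LsL LE exc; pose c i := projT1 (cid (exc i)).
have cP i : proper_coloring (c i) by exact: projT2 (cid (exc i)).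
(* Fallback for the coordinates [i] with [x] outside [Ls i]. Since ['I_n] may be empty, no color can
   be fixed in advance; [x] borrows its color in some subcomplex that contains it. *)
have default (x : vertices L) : {_ : 'I_n | True}.
  apply: cid; case: (set_mem (valP x)) => F; rewrite LE => -[i _ LiF] Fx.
  by exists (c i (SigSub (mem_set (vertices_simplex LiF Fx)))).
pose g (x : vertices L) : {ffun 'I_k -> 'I_n} := [ffun i =>
  if pselect (vertices (Ls i) (\val x)) is left h then c i (SigSub (mem_set h))
  else sval (default x)].
have cardE : #|{ffun 'I_k -> 'I_n}| = (n ^ k)%N by rewrite card_ffun !card_ord.
exists (fun x => cast_ord cardE (enum_rank (g x))) => F FL [a ca].
have [i _ LiF] : (\bigcup_i simplices (Ls i))%classic F.
  by rewrite -LE; case: FL => -[].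
apply: (cP i F); first by case: FL => /(facet_sub (LsL i) LiF).
(* If all vertices of [F] carried the tuple encoded by [a], its coordinate [i] would be their common
   color under [c i]. *)
exists (enum_val (cast_ord (esym cardE) a) i) => x Fx.
have Lx : \val x \in vertices L.
  by apply/mem_set; apply: vertices_simplex Fx; apply: LsL LiF.
rewrite -(ca (SigSub Lx) Fx) cast_ordK enum_rankK ffunE.
case: pselect => [h|[]]; last exact: set_mem (valP x).
by congr c; apply: val_inj.
Qed.

Lemma proper_coloring_expn {T U : Type} {L : simplicial_complex T}
    {K : simplicial_complex U} {k n : nat}
    {Ls : 'I_k -> simplicial_complex T} {c : vertices K -> 'I_n} :
  (forall i, subcomplex (Ls i) L) ->
  simplices L = (\bigcup_i simplices (Ls i))%classic ->
  (forall i, exists f : vertices (Ls i) -> vertices K,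
     facet_simplicial_map f) ->
  proper_coloring c ->
  exists c' : vertices L -> 'I_(n ^ k), proper_coloring c'.
Proof.
move=> LsL LE exf cP; apply: proper_coloring_cover LsL LE _ => i.
by have [f fP] := exf i; exists (c \o f); apply: proper_coloring_comp.
Qed.

Lemma chromatic_number_le_epow (R : realType) {T U : Type}
    (L : simplicial_complex T) (K : simplicial_complex U) :
  chromatic_number R L <= epow (chromatic_number R K) (facet_complexity R L K).
Proof.
rewrite /facet_complexity; case: leastP => [|k [k0 [Ls [LsL LE exf]]]].
  by rewrite /= leey.
rewrite [in leRHS]/chromatic_number; case: leastP => [|n [c cP]] /=.
  (* Positivity of [k] matters here: [+oo] to the power 0 is 1. *)
  by rewrite pnatr_eq0 eqn0Ngt k0 leey.
rewrite powR_mulrn ?ler0n// -natrX.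
exact/least_le/(proper_coloring_expn LsL LE exf cP).
Qed.

Lemma elog_nat_le {R : realType} {m n k : nat} :
  (1 < n)%N -> (m <= n ^ k)%N -> elog n%:R%:E m%:R%:E <= k%:R%:E :> \bar R.
Proof.
move=> n1 mnk; have n0 := ltnW n1.
have ln_n : (0 < ln n%:R :> R)%R by rewrite ln_gt0// ltr1n.
rewrite /elog /= !lern0 (gtn_eqF n0) inver (gt_eqF ln_n) lee_pdivrMr//.
(* The case [m = 0], the chromatic number of a complex without vertices, has logarithm [-oo]. *)
case: ifPn => [_|m0]; first by rewrite leNye.
rewrite -EFinM lee_fin mulr_natl -lnXn ?ltr0n// -natrX.
by rewrite ler_ln ?posrE ?ltr0n ?expn_gt0 ?n0 ?lt0n ?ler_nat.
Qed.

(** The image is taken of the preimage of [F] in the subtype [A], which injects into [F] through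
    [\val]. *)
Lemma card_sub_image_le {T U : Type} {A : set T} {B : set U} (f : A -> B)
  (F : set T) : (sub_image f F #<= F)%card.
Proof.
apply: card_le_trans (card_image_le _ _) _.
by apply: (@card_ge_preimage _ _ F \val) => x y _ _; apply: val_inj.
Qed.

Lemma sub_image_edge {T U : Type} {L : simplicial_complex T}
    {K : simplicial_complex U} {f : vertices L -> vertices K} {e : set T} :
  facet_simplicial_map f -> edge_facets L e -> edge_facets K (sub_image f e).
Proof.
move=> [_ ff] [Le]; rewrite card_eq_le => /andP[e_le2 e_ge2].
have [Kfe fe_ge2] := ff e (conj Le e_ge2).
split=> //; rewrite card_eq_le fe_ge2 andbT.
exact: card_le_trans (card_sub_image_le f e) e_le2.
Qed.

Lemma facet_graph_hom {T U : Type} {L : simplicial_complex T}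
    {K : simplicial_complex U} {f : vertices L -> vertices K}
    {G : sgraph T} :
  facet_simplicial_map f -> subgraph G (facet_graph L) ->
  exists g : gverts G -> gverts (facet_graph K), graph_hom g.
Proof.
move=> fP [GvL GeL].
have vL (x : gverts G) : \val x \in vertices L.
  have [e [[Le _] _] ex] := GvL _ (set_mem (valP x)).
  exact/mem_set/(vertices_simplex Le ex).
pose v x := f (SigSub (vL x)).
(* A vertex of [G] lies on an edge facet of [L], whose image is an edge facet of [K] through
   [v x]. *)
have vK x : \val (v x) \in gverts (facet_graph K).
  have [e Le ex] := GvL _ (set_mem (valP x)).
  apply/mem_set; exists (sub_image f e); first exact: sub_image_edge.
  by exists (SigSub (vL x)).
exists (fun x => SigSub (vK x)) => e Ge.
(* The two images run over different subtypes, [gverts G] and [vertices L]; they agree because [e]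
   lies inside [gverts G]. *)
suff -> : sub_image (fun x => SigSub (vK x)) e = sub_image f e.
  exact/sub_image_edge/GeL.
apply/seteqP; split=> [_ [x ex <-]|_ [x ex <-]].
  by exists (SigSub (vL x)).
exists (SigSub (mem_set (gedges_verts Ge ex))) => //=.
by congr (\val (f _)); apply: val_inj.
Qed.

Lemma hom_complexity_le (R : realType) {T U : Type}
    (L : simplicial_complex T) (K : simplicial_complex U) :
  hom_complexity R (facet_graph L) (facet_graph K) <= facet_complexity R L K.
Proof.
rewrite /facet_complexity; case: leastP => [|k [k0 [Ls [LsL LE exf]]]].
  exact: leey.
apply: least_le; split=> //.
(* Only facets of [L] are kept: a one-dimensional facet of [Ls i] may fail to be maximal in [L], and
   then it is no edge of [facet_graph L]. *)
pose E i := (edge_facets L `&` simplices (Ls i))%classic.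
have Ecard i e : E i e -> (e #= `I_2)%card by move=> [[]].
have Everts i e : E i e -> (e `<=` \bigcup_(F in E i) F)%classic.
  by move=> Ee x ex; exists e.
have EE : edge_facets L = (\bigcup_i E i)%classic.
  apply/seteqP; split=> [e Le|e [i _ []]//].
  have : simplices L e by case: Le => -[].
  by rewrite LE => -[i _ Lie]; exists i.
exists (fun i => SGraph (@Ecard i) (@Everts i)); split=> //.
- move=> i; split=> [x [e [Le _] ex]|e []//]; by exists e.
- apply/seteqP; split=> [x [e + ex]|x [i _ [e [Le _] ex]]]; last by exists e.
  by rewrite EE => -[i _ Ee]; exists i => //; exists e.
- move=> i; have [f fP] := exf i; apply: facet_graph_hom fP _.
  have EL e : E i e -> edge_facets (Ls i) e.
    by move=> [[/(facet_sub (LsL i)) + e2] Lie] => /(_ Lie).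
  by split=> [x [e Ee ex]|e /EL//]; exists e => //; apply: EL.
Qed.

Theorem theorem3p14 (R : realType) (T U : Type)
    (L : simplicial_complex T) (K : simplicial_complex U) :
  [/\ chromatic_number R L <=
        epow (chromatic_number R K) (facet_complexity R L K),
      2%:R%:E <= chromatic_number R K -> chromatic_number R K < +oo ->
        elog (chromatic_number R K) (chromatic_number R L) <=
          facet_complexity R L K
    & (forall v : U, ~ isolated_vertex K v) ->
        hom_complexity R (facet_graph L) (facet_graph K) <=
          facet_complexity R L K].
Proof.
have le_epow := chromatic_number_le_epow R L K.
split=> [//||_]; last exact: hom_complexity_le.
move: le_epow; rewrite /facet_complexity; case: leastP => [|k _].
  by rewrite !leey.
rewrite /chromatic_number.
(* The explicit predicate selects the chromatic number of [K], finite by hypothesis; that of [L] is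
   then finite by [le_epow]. *)
case: (leastP R (fun n => exists c : vertices K -> 'I_n, _)) => [//|n _].
case: leastP => [|m _]; first by rewrite /= leye_eq.
rewrite /= powR_mulrn ?ler0n// -natrX !lee_fin !ler_nat => mnk n2 _.
exact: elog_nat_le.
Qed.
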